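(* Let $X$ and $Y$ be two one-sided shift spaces, with shift maps $\sigma_X$ and $\sigma_Y$, and suppose that $h:X\to Y$ is a continuous orbit equivalence that maps eventually periodic points to eventually periodic points, that $(k,l)$ is a least period preserving $h$-cocycle pair, that $(k',l')$ is a least period preserving $h^{-1}$-cocycle pair, and that $b:X\to\mathbb{Z}$, $n:X\to\mathbb{N}_0$, $b':Y\to\mathbb{Z}$ and $n':Y\to\mathbb{N}_0$ are continuous maps such that $$l(x)-k(x)=n(x)+b(x)-b(\sigma_X(x))\quad\text{and}\quad l'(y)-k'(y)=n'(y)+b'(y)-b'(\sigma_Y(y))$$ for all $x\in X$ and $y\in Y$. Then the associated two-sided shift spaces $\mathbf{X}$ and $\mathbf{Y}$ are flow equivalent.
   Context: $\mathbb{N}$ is the set of positive integers and $\mathbb{N}_0$ the set of non-negative integers; $\mathbb{N}_0$ and $\mathbb{Z}$ carry the discrete topology. One-sided shift space: a closed subset $X\subseteq \boldsymbol{a}^{\mathbb{N}_0}$ ($\boldsymbol{a}$ a finite discrete alphabet, product topology) with $\sigma(X)=X$, where $(\sigma(x))_j=x_{j+1}$; $\sigma_X$ is the restriction of $\sigma$ to $X$. A point $x\in X$ is periodic if $\sigma_X^p(x)=x$ for some $p\in\mathbb{N}$, and eventually periodic if $\sigma_X^n(x)$ is periodic for some $n\in\mathbb{N}_0$. For eventually periodic $x$, its least period is $\operatorname{lp}(x):=\min\{p\in\mathbb{N}:\exists n,m\in\mathbb{N}_0,\ p=n-m,\ \sigma_X^n(x)=\sigma_X^m(x)\}$. A homeomorphism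 $h:X\to Y$ is a continuous orbit equivalence if there exist continuous maps $k,l:X\to\mathbb{N}_0$ and $k',l':Y\to\mathbb{N}_0$ with $\sigma_Y^{k(x)}(h(\sigma_X(x)))=\sigma_Y^{l(x)}(h(x))$ for all $x\in X$ and $\sigma_X^{k'(y)}(h^{-1}(\sigma_Y(y)))=\sigma_X^{l'(y)}(h^{-1}(y))$ for all $y\in Y$. Any pair $(k,l)$ of continuous maps satisfying the first identity is an $h$-cocycle pair; since $h^{-1}$ is also a continuous orbit equivalence, $h^{-1}$-cocycle pairs are the pairs $(k',l')$ of continuous maps satisfying the second identity. $h$ maps eventually periodic points to eventually periodic points if, for $x\in X$, $h(x)$ is eventually periodic exactly when $x$ is. In that case an $h$-cocycle pair $(k,l)$ is least period preserving if $\operatorname{lp}(h(x))=\sum_{i=0}^{\operatorname{lp}(x)-1}\bigl(l(\sigma_X^i(x))-k(\sigma_X^i(x))\bigr)$ for every eventually periodic point $x\in X$; the notion for $h^{-1}$-cocycle pairs is obtained by exchanging the roles of $X$ and $Y$ (and replacing $h$ by $h^{-1}$). The two-sided shift space associated to $X$ is $\mathbf{X}:=\{\mathbf{x}\in\boldsymbol{a}^{\mathbb{Z}}:(x_m,x_{m+1},\dots)\in X\text{ for all }m\in\mathbb{Z}\}$ with shift $\sigma_{\mathbf{X}}$, $(\sigma_{\mathbf{X}}(\mathbf{x}))_j=x_{j+1}$. Its suspension $S\mathbf{X}$ is the quotient (with quotient topology) of $\mathbf{X}\times\mathbb{R}$ by the smallest equivalence relation with $(\sigma_{\mathbf{X}}^n(\mathbf{x}),t)\sim(\mathbf{x},t+n)$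 for $\mathbf{x}\in\mathbf{X}$, $t\in\mathbb{R}$, $n\in\mathbb{Z}$; $[(\mathbf{x},t)]$ denotes the class of $(\mathbf{x},t)$. $\mathbf{X}$ and $\mathbf{Y}$ are flow equivalent if there is a homeomorphism $\psi:S\mathbf{X}\to S\mathbf{Y}$ mapping flow lines onto flow lines in an orientation preserving way: whenever $\psi([(\mathbf{x},t)])=[(\mathbf{y},r)]$ and $s,u>0$, there are $v>0$ with $\psi([(\mathbf{x},t+s)])=[(\mathbf{y},r+v)]$ and $w>0$ with $\psi^{-1}([(\mathbf{y},r+u)])=[(\mathbf{x},t+w)]$. *)

(* Defs.v *)
From HB Require Import structures.
From Stdlib Require Import Relation_Operators.
From mathcomp Require Import all_boot all_order all_algebra generic_quotient.
From mathcomp Require Import all_classical all_reals topology.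

Set Implicit Arguments.
Unset Strict Implicit.
Unset Printing Implicit Defensive.

Import Order.TTheory GRing.Theory Num.Theory numFieldTopology.Exports.

Local Open Scope classical_set_scope.
Local Open Scope ring_scope.
Local Open Scope quotient_scope.

Record homeo (T U : topologicalType) := Homeo {
  homeo_fun :> T -> U;
  homeo_invfun : U -> T;
  homeo_continuous : continuous homeo_fun;
  homeo_inv_continuous : continuous homeo_invfun;
  homeoK : cancel homeo_fun homeo_invfun;
  homeo_invK : cancel homeo_invfun homeo_fun }.

Definition homeo_inv (T U : topologicalType) (h : homeo T U) : homeo U T :=
  Homeo (@homeo_inv_continuous T U h) (@homeo_continuous T U h)
        (@homeo_invK T U h) (@homeoK T U h).

Section OneSided.
Variable A : finType.

Local Notation one_sided_full := {ptws nat -> discrete_topology A}.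

Definition full_shift (x : one_sided_full) : one_sided_full := fun j => x j.+1.

Record shift_space := ShiftSpace {
  shift_set :> set one_sided_full;
  shift_space_closed : closed shift_set;
  shift_space_image : full_shift @` shift_set = shift_set }.

Lemma full_shift_stable (X : shift_space) (x : X) :
  full_shift (set_val x) \in (X : set _).
Proof.
have: (full_shift @` X) (full_shift (set_val x))
  by exists (set_val x) => //; exact: set_valP.
by rewrite shift_space_image => /mem_set.
Qed.

Definition shift (X : shift_space) (x : X) : X := SigSub (full_shift_stable x).

Section Periods.
Variables (X : shift_space) (x : X).

Definition periodic_pt (y : X) : Prop :=
  exists2 p : nat, (0 < p)%N & iter p (@shift X) y = y.

Definition eventually_periodic : Prop :=
  exists n : nat, periodic_pt (iter n (@shift X) x).

Definition eventual_period (p : nat) : Prop :=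
  (0 < p)%N /\ exists n m : nat,
    p%:Z = n%:Z - m%:Z /\ iter n (@shift X) x = iter m (@shift X) x.

(* The value is 0 when [x] is not eventually periodic. *)
Definition lp : nat :=
  if pselect (exists p, `[< eventual_period p >]) is left e
  then ex_minn e else 0%N.

End Periods.
End OneSided.

Section OrbitEquivalence.
Variables (A B : finType) (X : shift_space A) (Y : shift_space B).
Variable h : homeo (set_type X) (set_type Y).

Definition cocycle_pair (k l : X -> nat) : Prop :=
  [/\ continuous k, continuous l &
      forall x : X,
        iter (k x) (@shift B Y) (h (shift x)) = iter (l x) (@shift B Y) (h x)].

Definition preserves_eventually_periodic : Prop :=
  forall x : X, eventually_periodic (h x) <-> eventually_periodic x.

Definition least_period_preserving (k l : X -> nat) : Prop :=
  forall x : X, eventually_periodic x ->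
    (lp (h x))%:Z =
    \sum_(0 <= i < lp x)
       ((l (iter i (@shift A X) x))%:Z - (k (iter i (@shift A X) x))%:Z).

End OrbitEquivalence.

Definition continuous_orbit_equivalence (A B : finType) (X : shift_space A)
    (Y : shift_space B) (h : homeo (set_type X) (set_type Y)) : Prop :=
  (exists k l : X -> nat, cocycle_pair h k l) /\
  (exists k' l' : Y -> nat, cocycle_pair (homeo_inv h) k' l').

Section TwoSided.
Variables (A : finType) (X : shift_space A).

Local Notation two_sided_full := {ptws int -> discrete_topology A}.

Definition two_sided : set two_sided_full :=
  [set x | forall m : int, shift_set X (fun i : nat => x (m + i%:Z))].

Lemma two_sided_shift_stable (c : int) (x : two_sided) :
  ((fun j => set_val x (j + c)) : two_sided_full) \in two_sided.
Proof.
apply/mem_set => m; have /(_ (m + c)) := set_valP x.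
by congr (shift_set X _); apply/funext => i; rewrite addrAC.
Qed.

Definition tshift (x : two_sided) : two_sided :=
  SigSub (two_sided_shift_stable 1 x).

Definition tshift_inv (x : two_sided) : two_sided :=
  SigSub (two_sided_shift_stable (-1) x).

Lemma tshiftK : cancel tshift tshift_inv.
Proof.
move=> x; apply/val_inj/funext => j /=.
by rewrite set_valE /= -addrA addNr addr0.
Qed.

Lemma tshift_invK : cancel tshift_inv tshift.
Proof.
move=> x; apply/val_inj/funext => j /=.
by rewrite set_valE /= -addrA addrN addr0.
Qed.

Definition tshift_iter (n : int) : two_sided -> two_sided :=
  match n with
  | Posz m => iter m tshift
  | Negz m => iter m.+1 tshift_inv
  end.

Variable R : realType.

Definition suspension_base := (set_type two_sided * R)%type.

Variant suspension_step : suspension_base -> suspension_base -> Prop :=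
  SuspensionStep (x : two_sided) (t : R) (n : int) :
    suspension_step (tshift_iter n x, t) (x, t + n%:~R).

Definition suspension_rel : rel suspension_base :=
  fun p q => `[< clos_refl_sym_trans _ suspension_step p q >].

Lemma suspension_rel_refl : reflexive suspension_rel.
Proof. by move=> p; apply/asboolP; exact: rst_refl. Qed.

Lemma suspension_rel_sym : symmetric suspension_rel.
Proof. by move=> p q; apply/asbool_equiv_eq; split; exact: rst_sym. Qed.

Lemma suspension_rel_trans : transitive suspension_rel.
Proof.
move=> q p r /asboolP pq /asboolP qr; apply/asboolP.
exact: rst_trans pq qr.
Qed.

Definition suspension_equiv : equiv_rel suspension_base :=
  EquivRel suspension_rel suspension_rel_refl suspension_rel_sym
           suspension_rel_trans.

Definition suspension := {eq_quot suspension_equiv}.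
HB.instance Definition _ :=
  Topological.copy suspension (quotient_topology suspension).
HB.instance Definition _ := Quotient.on suspension.

Definition suspension_class (x : two_sided) (t : R) : suspension :=
  (\pi_suspension ((x, t) : suspension_base))%qT.

End TwoSided.

(* [two_sided X] and [two_sided Y] are flow equivalent. *)
Definition flow_equivalent (R : realType) (A B : finType) (X : shift_space A)
    (Y : shift_space B) : Prop :=
  exists psi : homeo (suspension X R) (suspension Y R),
    forall (x : two_sided X) (t : R) (y : two_sided Y) (r s u : R),
      psi (suspension_class x t) = suspension_class y r -> 0 < s -> 0 < u ->
      (exists2 v : R, 0 < v &
         psi (suspension_class x (t + s)) = suspension_class y (r + v)) /\
      (exists2 w : R, 0 < w &
         homeo_inv psi (suspension_class y (r + u)) =
         suspension_class x (t + w)).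

(* Main.v *)
(* Adding a large constant to [b] gives a bounded [e : X -> nat] for which
   [g x := sigma^(e x) (h x)] satisfies the exact relation
   [g (sigma x) = sigma^(n x) (g x)].  Along an orbit on which [n] vanished, [g]
   would be constant, so [h] would take finitely many values and the point would be
   eventually periodic; but then [n] sums over a period to [lp (h x) > 0].  By
   compactness [n] is therefore positive at least once in every window of some fixed
   length [G].  Hence [g] extends to a map [ext] of two-sided points, placing
   [g (x_m x_(m+1) ...)] at position [N x m], the partial sums of [n], and
   [ext (sigma^c x) = sigma^(N x c) (ext x)].  Smoothing [N x] over windows of length
   [G] yields an increasing homeomorphism [f_x] of the real line, and
   [[x, t] |-> [ext x, f_x t]] is the flow equivalence.  It is a bijection because the
   extension built from [h^-1] inverts [ext] on shift orbits, and because on a periodic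
   orbit [n] sums exactly to the period of the image; as a continuous bijection from a
   compact onto a Hausdorff space it is a homeomorphism. *)
From mathcomp Require Import all_boot all_order all_algebra generic_quotient.
From mathcomp Require Import all_classical all_reals topology normedtype.
From mathcomp Require Import zify ring lra.
From Stdlib Require Import Relation_Operators.
(* Imported last: [normedtype] also defines a constant named [shift]. *)
Require Import Defs.

Set Implicit Arguments.
Unset Strict Implicit.
Unset Printing Implicit Defensive.

Import Order.TTheory GRing.Theory Num.Theory.
Import numFieldTopology.Exports numFieldNormedType.Exports.

Local Open Scope classical_set_scope.
Local Open Scope ring_scope.

(** * Locally constant maps and compactness *)

Definition locally_constant (T : topologicalType) (U : Type) (f : T -> U) :=
  forall x, \forall y \near x, f y = f x.

Section LocallyConstant.
Context {T : topologicalType}.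

Lemma lc_cst (U : Type) (c : U) : locally_constant (fun _ : T => c).
Proof. by move=> x; exact: filterE. Qed.

Lemma lc_bind (I U : Type) (c : T -> I) (f : I -> T -> U) :
  locally_constant c -> (forall i, locally_constant (f i)) ->
  locally_constant (fun x => f (c x) x).
Proof.
by move=> lc_c lc_f x; move: (lc_c x) (lc_f (c x) x); apply: filterS2 => y ->.
Qed.

Lemma lc_comp (U V : Type) (F : U -> V) (f : T -> U) :
  locally_constant f -> locally_constant (fun x => F (f x)).
Proof. by move=> lc_f x; move: (lc_f x); apply: filterS => y ->. Qed.

Lemma lc_continuous (S : topologicalType) (U : Type) (c : T -> S) (f : S -> U) :
  continuous c -> locally_constant f -> locally_constant (fun x => f (c x)).
Proof. by move=> cc lc_f x; apply: (cc x _ (lc_f (c x))). Qed.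

Lemma lc_sum (V : nmodType) (F : nat -> T -> V) n :
  (forall i, locally_constant (F i)) ->
  locally_constant (fun x => \sum_(0 <= i < n) F i x).
Proof.
move=> lcF; elim: n => [|n IHn].
  by move=> x; apply: filterE => y; rewrite !big_geq.
move=> x; move: (IHn x) (lcF n x); apply: filterS2 => y IH Fn.
by rewrite !big_nat_recr//= IH Fn.
Qed.

Lemma continuous_lc (D : discreteTopologicalType) (f : T -> D) :
  continuous f -> locally_constant f.
Proof. by move=> cf x; apply: (cf x [set f x]); apply: discrete_set1. Qed.

(** Near-covering form of compactness along the filter [\oo]: since [P] grows with [m], a stage that
    works on a neighbourhood still works there at all later stages. *)
Lemma compact_eventually (P : nat -> T -> Prop) :
  compact [set: T] -> {homo P : m n / (m <= n)%N >-> (m `<=` n)} ->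
  (forall x : T, exists m, \forall y \near x, P m y) ->
  exists m, forall x, P m x.
Proof.
move=> /compact_near_coveringP cT P_homo Pnear.
have [x _|m _ mP] := cT nat \oo P _.
  have [m Pm] := Pnear x; exists ([set y | P m y], [set k | m <= k]%N) => /=.
    by split=> //; exists m.
  by move=> [y k] /= [Py /P_homo]; apply.
by exists m => x; apply: mP => /=.
Qed.

Lemma lc_bounded (f : T -> nat) :
  compact [set: T] -> locally_constant f -> exists m, forall x, (f x <= m)%N.
Proof.
move=> cT lcf; apply: (@compact_eventually (fun m x => f x <= m)%N) => //.
  by move=> m n mn x /= /leq_trans; apply.
by move=> x; exists (f x); move: (lcf x); apply: filterS => y ->.
Qed.

End LocallyConstant.

Section Pointwise.
Context {I D : choiceType}.
Local Notation ptwsID := {ptws I -> discrete_topology D}.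

Lemma ptws_coord_lc (i : I) : locally_constant (fun x : ptwsID => x i).
Proof.
move=> x; have := @proj_continuous I (fun _ => discrete_topology D) i x.
by move/(_ [set x i]); apply; exact: discrete_set1.
Qed.

Lemma ptws_continuous_coord (T : topologicalType) (f : T -> ptwsID) :
  (forall i, locally_constant (fun t => f t i)) -> continuous f.
Proof.
move=> lcf t; apply/cvg_sup => i.
apply: (@continuous_comp_initial _ _ _ (fun f => f i)) => {}t.
by apply: (near_cst_continuous (f t i)); apply: lcf.
Qed.

Variable S : set ptwsID.

Lemma coord_lc (i : I) : locally_constant (fun x : S => set_val x i).
Proof.
apply: (@lc_continuous _ _ _ (set_val : S -> ptwsID) (fun x => x i)).
  exact: initial_continuous.
exact: ptws_coord_lc.
Qed.

Lemma continuous_coord (T : topologicalType) (f : T -> S) :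
  (forall i, locally_constant (fun t => set_val (f t) i)) -> continuous f.
Proof.
by move=> lcf; apply: continuous_comp_initial; apply: ptws_continuous_coord.
Qed.

End Pointwise.

Lemma compact_subtype (T : topologicalType) (S : set T) :
  compact S -> compact [set: S].
Proof.
move=> /compact_near_coveringP cS; apply/compact_near_coveringP => I F P FF cov.
pose Q i x := forall y : S, set_val y = x -> P i y.
have : \near F, S `<=` Q F.
  apply: cS => x Sx.
  have [[V W] /= [[V' [[V0 oV0 V0V'] V'x V'V]] FW] VW] := cov (SigSub (mem_set Sx)) Logic.I.
  exists (V0, W) => /=.
    split=> //; apply: open_nbhs_nbhs; split=> //.
    by rewrite -V0V' in V'x.
  move=> [z i] /= [V0z Wi] y yz; apply: (VW (y, i)); split=> //=.
  by apply: V'V; rewrite -V0V' /= yz.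
by apply: filterS => i SQ y _; apply: SQ (erefl _); apply: set_valP.
Qed.

Lemma compact_ptws_closed (I : eqType) (D : finType)
    (S : set {ptws I -> discrete_topology D}) : closed S -> compact S.
Proof.
move=> cS; apply: (subclosed_compact cS (B := setT)) => //.
have := @tychonoff I (fun _ => discrete_topology D) (fun _ => setT).
rewrite (_ : [set f | _] = setT); last exact/seteqP.
by apply=> i; apply: finite_compact; exact: finite_finset.
Qed.

Section CompactHausdorff.
Context {T U : topologicalType} (f : T -> U).
Hypotheses (cT : compact [set: T]) (hU : hausdorff_space U).
Hypotheses (cf : continuous f) (f_inj : injective f) (f_surj : forall y, exists x, f x = y).

(** The preimage of a closed set under the inverse [g] is its image under [f], which is compact and
    therefore closed in [U]. *)
Lemma compact_hausdorff_homeo : exists psi : homeo T U, homeo_fun psi = f.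
Proof.
have [g fg] : {g : U -> T & cancel g f}.
  by exists (fun y => sval (cid (f_surj y))) => y; case: cid.
have gf : cancel f g by move=> x; apply: f_inj; rewrite fg.
suff cg : continuous g by exists (Homeo cf cg gf fg).
apply/continuous_closedP => C clC.
have -> : g @^-1` C = f @` C.
  apply/seteqP; split=> [y Cgy|_ [x Cx <-]]; first by exists (g y).
  by rewrite /preimage/= gf.
apply: compact_closed => //; apply: continuous_compact.
  exact: continuous_subspaceT.
exact: subclosed_compact cT _.
Qed.

End CompactHausdorff.

(** * Integer sequences and least periods *)

Lemma int_shift_ind (P : int -> Prop) :
  P 0 -> (forall m, P m <-> P (m + 1)) -> forall m, P m.
Proof.
move=> P0 PS; elim/int_rect => // n IHn.
  by rewrite intS addrC -PS.
by rewrite PS (_ : _ + 1 = - n%:Z)//; lia.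
Qed.

Lemma iter_period (T : Type) (f : T -> T) (p m : nat) (x : T) :
  iter p f x = x -> iter (p * m) f x = x.
Proof. by move=> fx; elim: m => [|m IHm]; rewrite ?muln0// mulnS iterD IHm. Qed.

Section IntegerSequences.
Variable A : Type.
Implicit Types x y : int -> A.

Lemma periodic_mul x (p : int) : (forall j, x (j + p) = x j) ->
  forall c j, x (j + c * p) = x j.
Proof.
move=> xp c j; elim/int_shift_ind: c => [|c]; first by rewrite mul0r addr0.
by rewrite mulrDl mul1r addrA xp.
Qed.

(** Moving [j] to the right by [|j - N|] periods [P] brings it past [N] without changing either
    side. *)
Lemma eventually_periodic_eq x (P q : int) (N : int) : 0 < P ->
  (forall j, x (j + P) = x j) -> (forall j, N <= j -> x (j + q) = x j) ->
  forall j, x (j + q) = x j.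
Proof.
move=> P0 /periodic_mul xP xq j.
rewrite -(xP `|j - N|%:Z) addrAC xq ?xP//; nia.
Qed.

(* The shift may depend on the ray; if it keeps changing far to the left, then [x] is
   periodic. *)
Lemma shared_rays_shift x y :
  (forall K : int, exists a c : int,
     [/\ a <= K, c <= K & forall i : nat, y (a + i%:Z) = x (c + i%:Z)]) ->
  exists s : int, forall j, y j = x (j + s).
Proof.
move=> rays.
have raysE K : exists a c : int,
    [/\ a <= K, c <= K & forall j, a <= j -> y j = x (j + (c - a))].
  have [a [c [aK cK yx]]] := rays K; exists a, c; split=> // j aj.
  have -> : j = a + `|j - a|%:Z by lia.
  by rewrite yx; congr x; lia.
(* If [x] is periodic, the offset of one fixed ray works everywhere: [j] can be moved right by
   multiples of [P] until both rays cover it. *)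
have [[P [P0 xP]]|xNP] := pselect (exists P : int, 0 < P /\ forall j, x (j + P) = x j).
  have [a [c [_ _ yx]]] := raysE 0; exists (c - a) => j.
  have [a' [c' [a'j _ yx']]] := raysE j.
  have xM := periodic_mul xP.
  rewrite yx' // -(xM `|j - a|%:Z) addrAC -yx' ?yx; last 2 first.
    by nia.
    by nia.
  by rewrite addrAC xM.
(* If all rays starting far enough to the left have the same offset, that offset is the required
   shift. *)
have [[K sK]|] := pselect (exists K : int, exists s : int, forall a c : int,
    a <= K -> c <= K -> (forall j, a <= j -> y j = x (j + (c - a))) -> c - a = s).
  have [s sE] := sK; exists s => j.
  have [a [c [aK cK yx]]] := raysE (Num.min j K).
  by rewrite -(sE _ _ _ _ yx) ?yx//; lia.
move=> /forallNP noK; exfalso; apply: xNP.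
have xper K : exists p : int, 0 < p /\ forall j, K <= j -> x (j + p) = x j.
  have [a [c [aK cK yx]]] := raysE K.
  (* Two distinct offsets realized left of [K] make their difference a period of [x] from [K] on;
     the order of the offsets keeps the compared positions inside both rays. *)
  have gen a1 c1 a2 c2 : a1 <= K -> c1 <= K -> a2 <= K -> c2 <= K ->
      (forall j, a1 <= j -> y j = x (j + (c1 - a1))) ->
      (forall j, a2 <= j -> y j = x (j + (c2 - a2))) -> c1 - a1 < c2 - a2 ->
      exists p : int, 0 < p /\ forall j, K <= j -> x (j + p) = x j.
    move=> a1K c1K a2K c2K yx1 yx2 lt12; exists (c2 - a2 - (c1 - a1)); split; first lia.
    move=> j Kj; have := yx1 (j - (c1 - a1)); rewrite yx2; last by lia.
    by rewrite subrK => <-; [congr x|]; lia.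
  apply: contrapT => noper; apply: (noK K); exists (c - a) => a' c' a'K c'K yx'.
  have [lt|lt|//] := ltgtP (c' - a') (c - a); exfalso; apply: noper.
  - exact: (gen a' c' a c).
  - exact: (gen a c a' c').
(* The period [P] of the right half-line is carried to the left: a period [p] valid from [min j 0]
   on moves [j] to a nonnegative position. *)
have [P [P0 xP]] := xper 0; exists P; split=> // j.
have [p [p0 xp]] := xper (Num.min j 0).
have xpM (T : nat) i : Num.min j 0 <= i -> x (i + T%:Z * p) = x i.
  move=> ji; elim: T => [|T IHT]; first by rewrite mul0r addr0.
  by rewrite intS mulrDl mul1r addrCA addrC xp ?IHT//; nia.
by rewrite -(xpM `|j|%N (j + P)) ?(addrAC _ P) ?xP ?xpM//; nia.
Qed.

End IntegerSequences.

(** * Partial sums of a two-sided sequence of naturals *)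

Section PartialSums.
Implicit Types u : int -> nat.

(** The negative branch is signed so that the increment from [m] to [m + 1] is [u m] on both sides
    of 0. *)
Definition psum u (m : int) : int :=
  match m with
  | Posz p => \sum_(0 <= i < p) (u i%:Z)%:Z
  | Negz p => - \sum_(0 <= i < p.+1) (u (- i.+1%:Z))%:Z
  end.

Lemma psum0 u : psum u 0 = 0. Proof. by rewrite /= big_geq. Qed.

Lemma psumS u m : psum u (m + 1) = psum u m + (u m)%:Z.
Proof.
case: m => [p|[|p]].
- by rewrite -PoszD addn1 /= big_nat_recr.
- by rewrite (_ : _ + 1 = 0)// psum0 /= big_nat1 addNr.
rewrite (_ : _ + 1 = Negz p); last by lia.
rewrite /psum [in RHS]big_nat_recr//= opprD -addrA NegzE addNr addr0 //.
Qed.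

Lemma psum_shift u c m : psum (fun i => u (i + c)) m = psum u (m + c) - psum u c.
Proof.
elim/int_shift_ind: m => [|m]; first by rewrite psum0 add0r subrr.
rewrite psumS (_ : m + 1 + c = m + c + 1) ?psumS; last by lia.
by split=> H; lia.
Qed.

Lemma psumD u m (i : nat) :
  psum u (m + i%:Z) = psum u m + \sum_(0 <= j < i) (u (m + j%:Z))%:Z.
Proof.
elim: i => [|i IHi]; first by rewrite addr0 big_geq// addr0.
by rewrite big_nat_recr//= intS addrCA addrC psumS IHi addrA.
Qed.

Lemma psum_le u m m' : m <= m' -> psum u m <= psum u m'.
Proof.
move=> mm'; have -> : m' = m + `|m' - m|%:Z by lia.
by rewrite psumD lerDl sumr_ge0.
Qed.

Variables (u : int -> nat) (G : nat).
Hypothesis u_gap : forall m, exists2 i, (i < G)%N & (0 < u (m + i%:Z))%N.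

Lemma psum_gap m : psum u m + 1 <= psum u (m + G%:Z).
Proof.
have [i iG ui] := u_gap m.
rewrite (le_trans (y := psum u (m + i%:Z + 1)))// ?psum_le//; last by lia.
by rewrite psumS; have := @psum_le u m (m + i%:Z); lia.
Qed.

Lemma psum_gapM m (r : nat) : psum u m + r%:Z <= psum u (m + (G * r)%:Z).
Proof.
elim: r => [|r IHr]; first by rewrite muln0 !addr0.
have := psum_gap (m + (G * r)%:Z).
by rewrite mulnS (_ : m + _ + _ = m + (G + G * r)%N%:Z); lia.
Qed.

Lemma psum_unbounded_below (r : nat) : psum u (- (G * r)%:Z) <= - r%:Z.
Proof. by have := psum_gapM (- (G * r)%:Z) r; rewrite addNr psum0; lia. Qed.

End PartialSums.

(** * Least periods of eventually periodic points *)

Section LeastPeriod.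
Variables (A : finType) (X : shift_space A).
Implicit Types x : X.
Local Notation sh := (@shift A X).

Lemma eventual_periodP x p :
  eventual_period x p <-> (0 < p)%N /\ exists N, iter (p + N) sh x = iter N sh x.
Proof.
split=> [[p0 [n [m [pE nm]]]]|[p0 [N pN]]]; split=> //.
  by exists m; rewrite -nm; congr iter; lia.
by exists (p + N)%N, N; split=> //; lia.
Qed.

Lemma eventually_periodicP x :
  eventually_periodic x <-> exists p, eventual_period x p.
Proof.
split=> [[n [p p0 px]]|[p /eventual_periodP[p0 [N pN]]]].
  by exists p; apply/eventual_periodP; split=> //; exists n; rewrite iterD.
by exists N, p => //; rewrite -iterD.
Qed.

Lemma lp_min x p : eventual_period x p -> (lp x <= p)%N.
Proof.
move=> xp; rewrite /lp; case: pselect => // e; case: ex_minnP => q _; apply.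
exact/asboolP.
Qed.

Lemma lpP x : eventually_periodic x -> eventual_period x (lp x).
Proof.
move=> /eventually_periodicP [p xp]; rewrite /lp; case: pselect => [e|].
  by case: ex_minnP => q /asboolP.
by case; exists p; apply/asboolP.
Qed.

(** By Euclidean division, a nonzero remainder of [p] modulo [lp x] would be an eventual period
    below the least one. *)
Lemma lp_dvd x p : eventual_period x p -> (lp x %| p)%N.
Proof.
move=> xp; have /lpP/eventual_periodP [l0 [N lN]] : eventually_periodic x.
  by apply/eventually_periodicP; exists p.
have /eventual_periodP [_ [M pM]] := xp.
have lI c i : iter (lp x * c + (i + N)) sh x = iter (i + N) sh x.
  elim: c => [|c IHc]; first by rewrite muln0.
  rewrite (_ : (_ + _)%N = lp x * c + i + (lp x + N))%N; last by rewrite mulnS; lia.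
  by rewrite iterD lN -iterD -addnA.
rewrite /dvdn -leqn0 leqNgt; apply/negP => r0.
have : eventual_period x (p %% lp x)%N.
  apply/eventual_periodP; split=> //; exists (M + N)%N.
  rewrite addnA -(lI (p %/ lp x)%N).
  rewrite (_ : _ + (_ + N) = N + (p + M))%N; first by rewrite iterD pM -iterD addnC.
  by rewrite {3}(divn_eq p (lp x)) mulnC; lia.
move/lp_min; rewrite leqNgt ltn_mod l0//.
Qed.

(** The relation for [lp x] is known only from some step [N] on; as [x] returns to itself after
    [p * N >= N] steps, it already holds at step 0. *)
Lemma lp_periodic x : periodic_pt x -> iter (lp x) sh x = x.
Proof.
move=> [p p0 px]; have /lpP/eventual_periodP [l0 [N lN]] : eventually_periodic x.
  by exists 0%N, p.
have pN := iter_period N px.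
have NpN : (N <= p * N)%N by rewrite leq_pmull.
have : iter (lp x + (p * N - N + N))%N sh x = iter (p * N - N + N)%N sh x.
  by rewrite addnCA iterD lN -iterD.
by rewrite subnK// iterD pN.
Qed.

Lemma eventual_period_iter x i p :
  eventual_period (iter i sh x) p <-> eventual_period x p.
Proof.
rewrite !eventual_periodP; split=> -[p0 [N pN]]; split=> //.
  by exists (N + i)%N; rewrite addnA !iterD -iterD.
by exists N; rewrite -!iterD (addnC (p + N)%N) (addnC N) iterD pN -iterD.
Qed.

Lemma lp_iter x i : eventually_periodic x -> lp (iter i sh x) = lp x.
Proof.
move=> /lpP xp; have ixp := (eventual_period_iter x i (lp x)).2 xp.
apply/eqP; rewrite eqn_leq lp_min//= lp_min//; apply/eventual_period_iter/lpP.
by apply/eventually_periodicP; exists (lp x).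
Qed.

End LeastPeriod.

(** * Two-sided points and the suspension *)

Section TwoSidedPoints.
Variables (A : finType) (X : shift_space A).
Implicit Types (x : two_sided X) (c m : int).

(** One formula for all integer shifts avoids the sign cases of [tshift_iter]. *)
Definition tsh c x : two_sided X := SigSub (two_sided_shift_stable c x).

Lemma tshE c x j : set_val (tsh c x) j = set_val x (j + c).
Proof. by []. Qed.

Lemma two_sided_eq x y : (forall j, set_val x j = set_val y j) -> x = y.
Proof. by move=> xy; apply/val_inj/funext. Qed.

Lemma tsh0 x : tsh 0 x = x.
Proof. by apply: two_sided_eq => j; rewrite tshE addr0. Qed.

Lemma tsh_tsh c c' x : tsh c (tsh c' x) = tsh (c + c') x.
Proof. by apply: two_sided_eq => j; rewrite !tshE addrA. Qed.

Lemma tsh_mul p x : tsh p x = x -> forall c, tsh (c * p) x = x.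
Proof.
move=> xp c; elim/int_shift_ind: c => [|c]; first by rewrite mul0r tsh0.
by rewrite mulrDl mul1r -tsh_tsh xp.
Qed.

Lemma tshift_iterE c x : tshift_iter c x = tsh c x.
Proof.
case: c => n /=.
  elim: n => [|n IHn]; first by rewrite tsh0.
  by rewrite iterS IHn intS -tsh_tsh.
rewrite -iterS (_ : Negz n = - n.+1%:Z)//.
elim: n.+1 => [|k IHk]; first by rewrite tsh0.
by rewrite iterS IHk (_ : - k.+1%:Z = -1 - k%:Z) -?tsh_tsh//; lia.
Qed.

Lemma ray_subproof x m :
  ((fun i => set_val x (m + i%:Z)) : {ptws nat -> discrete_topology A}) \in (X : set _).
Proof. by apply/mem_set; apply: (set_valP x m). Qed.

Definition ray x m : X := SigSub (ray_subproof x m).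

Lemma rayE x m i : set_val (ray x m) i = set_val x (m + i%:Z).
Proof. by []. Qed.

Lemma one_sided_eq (x y : X) : (forall j, set_val x j = set_val y j) -> x = y.
Proof. by move=> xy; apply/val_inj/funext. Qed.

Lemma shiftE (x : X) i : set_val (shift x) i = set_val x i.+1.
Proof. by []. Qed.

Lemma iter_shiftE (x : X) n i : set_val (iter n (@shift A X) x) i = set_val x (n + i)%N.
Proof. by elim: n i => // n IHn i; rewrite iterS shiftE IHn addnS. Qed.

Lemma iter_shift_ray x m n : iter n (@shift A X) (ray x m) = ray x (m + n%:Z).
Proof.
by apply: one_sided_eq => j; rewrite iter_shiftE !rayE PoszD addrA.
Qed.

Lemma shift_ray x m : shift (ray x m) = ray x (m + 1).
Proof. by rewrite -iter_shift_ray. Qed.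

Lemma ray_tsh c x m : ray (tsh c x) m = ray x (m + c).
Proof. by apply: one_sided_eq => j; rewrite !rayE tshE addrAC. Qed.

Lemma iter_shift_continuous n : continuous (iter n (@shift A X)).
Proof.
apply: continuous_coord => j x; have := coord_lc (S := X) (n + j)%N x.
by apply: filterS => y; rewrite !iter_shiftE.
Qed.

Lemma ray_continuous m : continuous (ray^~ m).
Proof. by apply: continuous_coord => j; apply: coord_lc. Qed.

Lemma tsh_continuous c : continuous (tsh c).
Proof. by apply: continuous_coord => j; apply: coord_lc. Qed.

Lemma shift_space_compact : compact [set: X].
Proof. exact/compact_subtype/compact_ptws_closed/shift_space_closed. Qed.

Lemma two_sided_closed : closed (two_sided X).
Proof.
have -> : two_sided X = \bigcap_(m in [set: int])
    ((fun (x : {ptws int -> discrete_topology A}) i => x (m + i%:Z))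
       : _ -> {ptws nat -> discrete_topology A}) @^-1` X.
  by apply/seteqP; split=> [x Xx m _|x Xx m]; [exact: Xx|exact: (Xx m Logic.I)].
apply: closed_bigI => m _; apply: closed_comp; last exact: shift_space_closed.
by move=> x _; apply: ptws_continuous_coord => i; apply: ptws_coord_lc.
Qed.

Lemma two_sided_compact : compact [set: two_sided X].
Proof. exact/compact_subtype/compact_ptws_closed/two_sided_closed. Qed.

Lemma two_sided_separated x y : x <> y -> exists U V : set (two_sided X),
  [/\ nbhs x U, nbhs y V & forall z, U z -> ~ V z].
Proof.
move=> xy; have [j xyj] : exists j, set_val x j <> set_val y j.
  by apply/existsNP => /two_sided_eq.
exists [set z | set_val z j = set_val x j], [set z | set_val z j = set_val y j].
split; [exact: (coord_lc j x)|exact: (coord_lc j y)|].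
by move=> z /= zx zy; apply: xyj; rewrite -zx.
Qed.

(** * The suspension as a compact Hausdorff space *)

Section Suspension.
Variable R : realType.
Implicit Types t r : R.

(** The generating steps already form the orbit relation of an action of the integers, so a single
    shift [d] accounts for any chain of steps. *)
Lemma suspension_classP x y t r :
  suspension_class x t = suspension_class y r <->
  exists d : int, x = tsh d y /\ r = t + d%:~R.
Proof.
have classP z s : reflect (suspension_class z s = suspension_class y r)
    (suspension_rel (z, s) (y, r)).
  exact: (@eqmodP _ (suspension_equiv X R)).
split.
  move=> /classP /asboolP.
  suff H p q : clos_refl_sym_trans _ (@suspension_step A X R) p q ->
      exists d : int, p.1 = tsh d q.1 /\ q.2 = p.2 + d%:~R by move=> /H.
  elim=> [_ _ [z s c]|z|p' q' _ [d [-> ->]]|p1 p2 p3 _ [d [-> d2]] _ [e [-> e2]]].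
  - by exists c; rewrite tshift_iterE.
  - by exists 0; rewrite tsh0 addr0.
  - by exists (- d); rewrite tsh_tsh addNr tsh0 intrN addrK.
  - by exists (d + e); rewrite tsh_tsh e2 d2 intrD addrA.
move=> [d [-> rE]]; apply/classP/asboolP/rst_step; rewrite rE.
by rewrite -tshift_iterE; apply: SuspensionStep.
Qed.

Lemma suspension_class_tsh d x t :
  suspension_class (tsh d x) t = suspension_class x (t + d%:~R).
Proof. by apply/suspension_classP; exists d. Qed.

Lemma suspension_classK (p : suspension X R) :
  exists x t, p = suspension_class x t.
Proof. by elim/quotW: p => -[x t]; exists x, t. Qed.

(** Every class has a representative with time in [[0, 1]], so the suspension is the image of a
    compact slab. *)
Lemma suspension_compact : compact [set: suspension X R].
Proof.
have -> : [set: suspension X R] =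
    \pi_(suspension X R)%qT @` ([set: two_sided X] `*` `[0, 1]%classic).
  apply/seteqP; split=> // p _; have [x [t ->]] := suspension_classK p.
  exists (tsh (Num.floor t) x, t - (Num.floor t)%:~R).
    split=> //=; rewrite in_itv /= subr_ge0 floor_le /=.
    by have := floorD1_gt t; rewrite intrD; lra.
  exact: (etrans (suspension_class_tsh _ _ _) (congr1 _ (subrK _ _))).
apply: continuous_compact; first exact/continuous_subspaceT/pi_continuous.
by apply: compact_setX; [exact: two_sided_compact|exact: segment_compact].
Qed.

(** Once [U] is shrunk to an open set, the preimage in [two_sided X * R] is a union of integer
    translates of an open product. *)
Lemma nbhs_suspension x t (U : set (two_sided X)) (e : R) : nbhs x U -> 0 < e ->
  nbhs (suspension_class x t)
    [set p | exists z s, [/\ p = suspension_class z s, U z & `|t - s| < e]].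
Proof.
rewrite nbhsE => -[U0 [oU0 U0x] U0U] e0.
pose W := [set p : suspension X R |
  exists z s, [/\ p = suspension_class z s, U0 z & `|t - s| < e]].
have W_open : open W.
  have pre z s : (\pi_(suspension X R)%qT @^-1` W) (z, s) <->
      exists d : int, U0 (tsh d z) /\ `|t - (s - d%:~R)| < e.
    split.
      move=> [z' [s' [/(suspension_classP z z' s s') [d [-> ->]] Uz ts]]].
      by exists (- d); rewrite tsh_tsh addNr tsh0 intrN opprK.
    move=> [d [Uz ts]]; exists (tsh d z), (s - d%:~R); split=> //.
    by rewrite suspension_class_tsh subrK.
  suff : open (\pi_(suspension X R)%qT @^-1` W) by [].
  rewrite openE => -[z s] /pre [d [Uz ts]].
  have zU : \forall z' \near z, U0 (tsh d z').
    by apply: (tsh_continuous (x := z)); apply: open_nbhs_nbhs.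
  have sB : \forall s' \near s, `|t - (s' - d%:~R)| < e.
    have e'0 : 0 < e - `|t - (s - d%:~R)| by rewrite subr_gt0.
    have := nbhsx_ballx s _ e'0; apply: filterS => s' ss'.
    have -> : t - (s' - d%:~R) = (t - (s - d%:~R)) + (s - s') by ring.
    by rewrite (le_lt_trans (ler_normD _ _))// -ltrBrDl.
  exists ([set z' | U0 (tsh d z')], [set s' | `|t - (s' - d%:~R)| < e]) => //.
  by move=> [z' s'] [/= Uz' ts']; apply/pre; exists d.
apply: filterS (open_nbhs_nbhs (conj W_open _)) => [p [z [s [-> /U0U Uz ts]]]|].
  by exists z, s.
by exists x, t; split=> //; rewrite subrr normr0.
Qed.

(** The bound [e + e] serves to compare two times, each known up to [e]. For a non-integer [u], no
    integer satisfies the premise. *)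
Lemma int_isolated (u : R) : exists2 e : R, 0 < e &
  forall c : int, `|c%:~R - u| < e + e -> u = c%:~R.
Proof.
have [fu uf] := (floor_le u, floorD1_gt u); set f := Num.floor u in fu uf.
have cE (c : int) : (c <= f) || (f + 1 <= c) by lia.
rewrite intrD in uf.
have [ufE|nuf] := eqVneq u f%:~R.
  exists (2^-1); first by rewrite invr_gt0.
  move=> c; have -> : 2^-1 + 2^-1 = 1 :> R by lra.
  rewrite ufE -intrB -intr_norm (ltr_int _ _ 1) => cf.
  by congr (_%:~R); lia.
have fu' : f%:~R < u by rewrite lt_neqAle eq_sym nuf.
exists (Num.min (u - f%:~R) (f%:~R + 1 - u) / 2) => [|c].
  by rewrite divr_gt0// lt_min !subr_gt0 fu' uf.
rewrite -splitr lt_min => /andP [h1 h2]; exfalso; move: h1 h2.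
have /orP [] := cE c; rewrite -(ler_int R) ?intrD => hc; case: ltrgt0P; lra.
Qed.

(* The shift acts properly discontinuously on [two_sided X * R]. *)
Lemma suspension_hausdorff : hausdorff_space (suspension X R).
Proof.
move=> p q; have [x [t ->]] := suspension_classK p.
have [y [r ->]] := suspension_classK q => clust.
apply/suspension_classP.
have [e e0 eP] := int_isolated (r - t).
(* The times of a common class are within [e] of [t] and of [r], so [r - t] is within [e + e] of the
   integer [d] and must equal it. *)
have meet U V : nbhs x U -> nbhs y V ->
    exists z z' (d : int), [/\ U z, V z', z = tsh d z' & r - t = d%:~R].
  move=> xU yV.
  have [_ [/= [z [s [-> Uz ts]]] [z' [s' [/suspension_classP [d [zE s'E]] Vz' rs]]]]] :=
    clust _ _ (nbhs_suspension t xU e0) (nbhs_suspension r yV e0).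
  exists z, z', d; split=> //; apply: eP.
  have -> : d%:~R - (r - t) = (t - s) - (r - s') by rewrite s'E; ring.
  by apply: le_lt_trans (ler_normB _ _) _; apply: ltrD.
have [_ [_ [d [_ _ _ rtd]]]] := meet setT setT filterT filterT.
exists d; split; last by rewrite -rtd addrC subrK.
(* If [x] and [tsh d y] differed, their separating neighbourhoods would still meet through a shift
   [c] with [r - t = c], so that [c = d]. *)
apply: contrapT => /two_sided_separated [U [V [xU yV UV]]].
have [z [z' [c [Uz Vz' zE rtc]]]] := meet _ _ xU (tsh_continuous yV).
apply: (UV _ Uz); rewrite zE; suff -> : c = d by [].
by apply: (@intr_inj R); rewrite -rtc.
Qed.

End Suspension.
End TwoSidedPoints.

(** * Extension of a semiconjugacy to two-sided points *)

Section TwoSidedExtension.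
Variables (A B : finType) (X : shift_space A) (Y : shift_space B).
Variables (n : X -> nat) (g : X -> Y) (G : nat).
Hypothesis n_lc : locally_constant n.
Hypothesis g_continuous : continuous g.
Hypothesis g_shift : forall x, g (shift x) = iter (n x) (@shift B Y) (g x).
Hypothesis n_gap : forall x, exists2 i, (i < G)%N & (0 < n (iter i (@shift A X) x))%N.

Implicit Types x : two_sided X.

Definition speed x (m : int) : nat := n (ray x m).
Local Notation N x := (psum (speed x)).

Lemma speed_gap x m : exists2 i, (i < G)%N & (0 < speed x (m + i%:Z))%N.
Proof.
by have [i iG ni] := n_gap (ray x m); exists i; rewrite // /speed -iter_shift_ray.
Qed.

Lemma speed_lc m : locally_constant (fun x => speed x m).
Proof.
by apply: (@lc_continuous _ _ _ (fun x => ray x m) n) => //; apply: ray_continuous.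
Qed.

Lemma psum_speed_lc m : locally_constant (fun x => N x m).
Proof.
case: m => p; last apply: (@lc_comp _ _ _ -%R).
  by apply: lc_sum => i; apply: (@lc_comp _ _ _ Posz); apply: speed_lc.
by apply: lc_sum => i; apply: (@lc_comp _ _ _ Posz); apply: speed_lc.
Qed.

Lemma speed_tsh c x : speed (tsh c x) = fun m => speed x (m + c).
Proof. by apply/funext => m; rewrite /speed ray_tsh. Qed.

Lemma g_ray x m (i : nat) :
  g (ray x (m + i%:Z)) = iter `|N x (m + i%:Z) - N x m|%N (@shift B Y) (g (ray x m)).
Proof.
elim: i => [|i IHi]; first by rewrite addr0 subrr.
have E : m + i.+1%:Z = m + i%:Z + 1 by lia.
rewrite E -shift_ray g_shift IHi -iterD psumS; congr iter.
have := @psum_le (speed x) m (m + i%:Z); rewrite /speed; lia.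
Qed.

(** For this [m] the gap condition gives [N x m <= - |j| <= j], so position [j] lies on the ray
    placed at [N x m]. *)
Definition ext_seq x : {ptws int -> discrete_topology B} := fun j =>
  let m := - (G * `|j|)%:Z in set_val (g (ray x m)) `|j - N x m|%N.

(** By [g_ray], the rays placed from two admissible base points agree at [j], so the choice of [m]
    is immaterial. *)
Lemma ext_seqE x m j : N x m <= j ->
  ext_seq x j = set_val (g (ray x m)) `|j - N x m|%N.
Proof.
have wlog_le m1 m2 : m1 <= m2 -> N x m2 <= j ->
    set_val (g (ray x m1)) `|j - N x m1|%N = set_val (g (ray x m2)) `|j - N x m2|%N.
  move=> m12 Nj; have m2E : m2 = m1 + `|m2 - m1|%:Z by lia.
  have N12 := psum_le (speed x) m12.
  by rewrite m2E g_ray -m2E iter_shiftE; congr (set_val _ _); lia.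
move=> Nj; rewrite /ext_seq; set m0 := - _.
have N0j : N x m0 <= j.
  by have := psum_unbounded_below (speed_gap x) `|j|%N; rewrite -/m0; lia.
by have [mm|/ltW mm] := leP m m0; [rewrite -(wlog_le m)|exact: wlog_le].
Qed.

Lemma ext_subproof x : ext_seq x \in two_sided Y.
Proof.
apply/mem_set => j; pose m := - (G * `|j|)%:Z.
have Nj : N x m <= j by have := psum_unbounded_below (speed_gap x) `|j|%N; rewrite -/m; lia.
have := set_valP (iter `|j - N x m|%N (@shift B Y) (g (ray x m))).
congr (shift_set Y _); apply/funext => i.
rewrite (@ext_seqE x m); last by lia.
by apply: etrans (iter_shiftE _ _ _) _; congr (set_val _ _); lia.
Qed.

Definition ext x : two_sided Y := SigSub (ext_subproof x).

Lemma ray_ext x m : ray (ext x) (N x m) = g (ray x m).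
Proof.
apply: one_sided_eq => i; rewrite rayE.
have -> : set_val (ext x) (N x m + i%:Z) = ext_seq x (N x m + i%:Z) by [].
by rewrite (@ext_seqE x m); [congr (set_val _ _)|]; lia.
Qed.

Lemma ext_tsh c x : ext (tsh c x) = tsh (N x c) (ext x).
Proof.
apply: two_sided_eq => j; rewrite tshE.
pose m := - (G * `|j|)%:Z.
have Nj : N (tsh c x) m <= j.
  by have := psum_unbounded_below (speed_gap (tsh c x)) `|j|%N; rewrite -/m; lia.
have -> : set_val (ext (tsh c x)) j = ext_seq (tsh c x) j by [].
have -> : set_val (ext x) (j + N x c) = ext_seq x (j + N x c) by [].
rewrite (ext_seqE Nj) (@ext_seqE x (m + c)); first rewrite ray_tsh.
  by congr (set_val _ _); rewrite speed_tsh psum_shift opprB addrA.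
by move: Nj; rewrite speed_tsh psum_shift lerBlDr.
Qed.

Lemma ext_continuous : continuous ext.
Proof.
apply: continuous_coord => j; rewrite /=.
set m := - (G * `|j|)%:Z.
apply: (@lc_bind _ _ _ (fun x => N x m) (fun p x => set_val (g (ray x m)) `|j - p|%N)).
  exact: psum_speed_lc.
move=> p.
apply: (@lc_continuous _ _ _ (fun x => g (ray x m)) (fun y => set_val y `|j - p|%N)).
  by move=> x; apply: continuous_comp; [exact: ray_continuous|exact: g_continuous].
exact: coord_lc.
Qed.

End TwoSidedExtension.

(** * The time change *)

Section TimeChange.
Variable R : realType.

Definition ramp (G : nat) (s : R) : R := Num.min 1 (Num.max 0 (s / G%:R)).

Lemma ramp_le0 G s : s <= 0 -> ramp G s = 0.
Proof.
move=> s0; have h : s / G%:R <= 0 by rewrite mulr_le0_ge0// invr_ge0.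
by rewrite /ramp (max_l h) min_r.
Qed.

Lemma ramp_ge1 G s : (0 < G)%N -> G%:R <= s -> ramp G s = 1.
Proof.
move=> G0 Gs; have h : 1 <= s / G%:R by rewrite ler_pdivlMr ?ltr0n// mul1r.
by rewrite /ramp max_r ?min_l//; lra.
Qed.

Lemma ramp_itv G s : (0 < G)%N -> 0 <= s <= G%:R -> ramp G s = s / G%:R.
Proof.
move=> G0 /andP[s0 sG]; rewrite /ramp max_r ?min_r//.
  by rewrite ler_pdivrMr ?ltr0n// mul1r.
by rewrite divr_ge0.
Qed.

Lemma ramp_homo G : {homo ramp G : s t / s <= t}.
Proof.
move=> s t st; rewrite /ramp; have : s / G%:R <= t / G%:R by rewrite ler_wpM2r// invr_ge0.
by move=> h; rewrite le_min !ge_min lexx /= ge_max !le_max lexx h /= !orbT.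
Qed.

Lemma ramp_lt G s t : 0 <= s < G%:R -> s < t -> ramp G s < ramp G t.
Proof.
move=> /andP[s0 sG] st; have G0 : (0 < G)%N by rewrite -(ltr0n R); lra.
have [tG|/ltW Gt] := leP t G%:R.
  by rewrite !ramp_itv ?s0 ?(ltW sG)//; [rewrite ltr_pM2r// invr_gt0 ltr0n|lra].
by rewrite (ramp_ge1 G0 Gt) ramp_itv ?s0 ?(ltW sG)// ltr_pdivrMr ?ltr0n// mul1r.
Qed.

Lemma ramp_continuous G : continuous (ramp G).
Proof.
move=> s; apply: (@continuous_min R R (cst 1) (cst 0 \max (fun s => s / G%:R)) s).
  exact: cst_continuous.
apply: continuous_max; first exact: cst_continuous.
by apply: cvgMl; exact: cvg_id.
Qed.

Variable G : nat.
Hypothesis G_gt0 : (0 < G)%N.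
Implicit Types (u : int -> nat) (s t : R).

(** Index [i] handles the jumps at [i] and at [- i.+1]. As in [psum], a jump left of 0 counts
    negatively, by its unfinished part, so that terms of large index vanish. *)
Definition tc_term u t (i : nat) : R :=
  (u i%:Z)%:R * ramp G (t - i%:R) - (u (- i.+1%:Z))%:R * (1 - ramp G (t + i.+1%:R)).

Definition tc_sum u (M : nat) t : R := \sum_(0 <= i < M) tc_term u t i.

(* The jump [u i] of [psum u] is spread linearly over the time interval [[i, i + G]]. *)
Definition time_change u t : R := tc_sum u (Num.bound `|t| + G) t.

Lemma tc_term0 u t i : `|t| + G%:R <= i%:R -> tc_term u t i = 0.
Proof.
move=> ti; have := ler_norm t; have := ler_norm (- t); rewrite normrN => tN tP.
have G0 : 0 <= G%:R :> R by [].
rewrite /tc_term ramp_le0 ?ramp_ge1//; first by rewrite subrr !mulr0 subrr.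
  by rewrite -natr1; lra.
by lra.
Qed.

Lemma time_changeE u M t : `|t| + G%:R <= M%:R -> time_change u t = tc_sum u M t.
Proof.
have stable M1 M2 : (M1 <= M2)%N -> `|t| + G%:R <= M1%:R -> tc_sum u M2 t = tc_sum u M1 t.
  move=> M12 tM; rewrite /tc_sum (big_cat_nat (n := M1))//= -[RHS]addr0; congr (_ + _).
  rewrite big_nat big1// => i /andP[Mi _].
  by apply: tc_term0; rewrite (le_trans tM)// ler_nat.
move=> tM; rewrite /time_change; set M' := (_ + G)%N.
have tM' : `|t| + G%:R <= M'%:R.
  by rewrite natrD lerD2r ltW// archi_boundP.
by have [MM|/ltnW MM] := leqP M M'; [exact: stable|rewrite (stable M')].
Qed.

Lemma exists_large t : exists M : nat, `|t| + G%:R <= M%:R.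
Proof.
exists (Num.bound (`|t| + G%:R)); apply/ltW/(le_lt_trans (ler_norm _)).
by rewrite -[X in _ < X]/(_%:R) ger0_norm ?addr_ge0// archi_boundP// addr_ge0.
Qed.

(** Reindexing moves only the jump at 0 across the origin, from the [ramp] part to the [1 - ramp]
    part; the two weights add up to 1. *)
Lemma time_change_shift1 u t :
  time_change (fun i => u (i + 1)) t = time_change u (t + 1) - (u 0)%:R.
Proof.
(* The room for [|t| + 1] lets one truncation [M] serve both [t] and [t + 1]. *)
have [M tM] := exists_large (`|t| + 1).
have tM0 : `|t| + 1 + G%:R <= M%:R by apply: le_trans tM; rewrite lerD2r ler_norm.
have tM1 : `|t + 1| + G%:R <= M%:R.
  by apply: le_trans tM0; rewrite lerD2r (le_trans (ler_normD _ _))// normr1.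
rewrite (@time_changeE _ M) ?(@time_changeE _ M)//; last by lra.
pose a i := (u i%:Z)%:R * ramp G (t + 1 - i%:R).
pose b i := (u (- i%:Z))%:R * (1 - ramp G (t + 1 + i%:R)).
have -> : tc_sum (fun i => u (i + 1)) M t = \sum_(0 <= i < M) (a i.+1 - b i).
  apply: eq_bigr => i _; rewrite /tc_term /a /b.
  congr (_%:R * ramp G _ - _%:R * (1 - ramp G _)).
  - by congr u; lia.
  - by rewrite -natr1; ring.
  - by congr u; lia.
  - by rewrite -natr1; ring.
have -> : tc_sum u M (t + 1) = \sum_(0 <= i < M) (a i - b i.+1) by [].
have tele (c : nat -> R) : \sum_(0 <= i < M) c i.+1 = \sum_(0 <= i < M) c i + c M - c 0%N.
  by rewrite -[LHS](addrK (c 0%N)) [_ + c 0%N]addrC -big_nat_recl// big_nat_recr.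
rewrite !sumrB !tele.
have -> : a M = 0.
  by rewrite /a ramp_le0 ?mulr0//; have := ler_norm (t + 1); have : 0 <= G%:R :> R by []; lra.
have -> : b M = 0.
  rewrite /b ramp_ge1 ?subrr ?mulr0//; have := ler_norm (- (t + 1)); rewrite normrN; lra.
have <- : a 0%N + b 0%N = (u 0)%:R by rewrite /a /b !(mulr0n, oppr0, addr0); ring.
by ring.
Qed.

Lemma time_change_shift u c t :
  time_change (fun i => u (i + c)) t = time_change u (t + c%:~R) - (psum u c)%:~R.
Proof.
elim/int_shift_ind: c t => [t|c].
  rewrite psum0 subr0 addr0; congr time_change; apply/funext => i; rewrite addr0//.
have step t : time_change (fun i => u (i + (c + 1))) t =
    time_change (fun i => u (i + c)) (t + 1) - (u c)%:R.
  rewrite -[in u c](add0r c) -(time_change_shift1 (fun i => u (i + c))).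
  by congr time_change; apply/funext => i; congr u; lia.
split=> IH t.
  rewrite step IH psumS !intrD -pmulrn (_ : t + 1 + _ = t + (c%:~R + 1)); last by ring.
  by move: (time_change _ _) => p; ring.
have := IH (t - 1); rewrite step subrK psumS !intrD -pmulrn => H.
have -> : t + c%:~R = t - 1 + (c%:~R + 1) by ring.
by move: H; move: (time_change _ _) (time_change _ _) => p q; lra.
Qed.

Lemma tc_sum_continuous u M : continuous (tc_sum u M).
Proof.
elim: M => [|M IHM] t; rewrite /tc_sum.
  under eq_fun do rewrite big_geq//.
  exact: cvg_cst.
under eq_fun do rewrite big_nat_recr//=.
apply: cvgD; first exact: IHM.
have rampc (c : R) : {for t, continuous (fun t => ramp G (t + c))}.
  apply: (@continuous_comp _ _ _ (fun t => t + c) (ramp G)); last exact: ramp_continuous.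
  by apply: cvgD; [exact: cvg_id|exact: cvg_cst].
apply: cvgB; (apply: cvgM; first exact: cvg_cst).
  exact: rampc.
by apply: cvgB; [exact: cvg_cst|exact: rampc].
Qed.

(** Near a given point one truncation [M] serves all times and the finitely many jumps involved are
    constant, so the map is locally a fixed [tc_sum]. *)
Lemma time_change_continuous2 (T : topologicalType) (v : T -> int -> nat) :
  (forall m, locally_constant (v^~ m)) ->
  continuous (fun p : T * R => time_change (v p.1) p.2).
Proof.
move=> v_lc [x t].
have [M tM] := exists_large (`|t| + 1).
have near_t : \forall s \near t, `|s| + G%:R <= M%:R.
  have := nbhsx_ballx t _ ltr01; apply: filterS => s ts.
  apply: le_trans tM; rewrite lerD2r (le_trans _ (ler_norm _))//.
  have -> : s = t - (t - s) by ring.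
  by rewrite (le_trans (ler_normB _ _))// lerD2l ltW.
have near_x : \forall y \near x, forall i : nat, (i < M)%N ->
    v y i%:Z = v x i%:Z /\ v y (- i.+1%:Z) = v x (- i.+1%:Z).
  elim: (M) => [|k IHk]; first exact: filterE.
  move: IHk (v_lc k%:Z x) (v_lc (- k.+1%:Z) x); apply: filterS3 => y IHk vk vk' i.
  by rewrite ltnS leq_eqVlt => /orP[/eqP ->|/IHk].
have eq_near : \forall p \near (x, t), tc_sum (v x) M p.2 = time_change (v p.1) p.2.
  exists ([set y | forall i : nat, (i < M)%N ->
      v y i%:Z = v x i%:Z /\ v y (- i.+1%:Z) = v x (- i.+1%:Z)],
    [set s | `|s| + G%:R <= M%:R]) => //.
  move=> [y s] /= [vy sM]; rewrite (@time_changeE _ M)//.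
  by apply: eq_big_nat => i /andP[_ iM]; rewrite /tc_term (vy i iM).1 (vy i iM).2.
have /= e := nbhs_singleton eq_near; rewrite /continuous_at /= -e.
apply: (cvg_trans (near_eq_cvg eq_near)).
apply: (@cvg_comp _ _ _ snd (tc_sum (v x) M) _ (nbhs t)); first exact: cvg_snd.
exact: tc_sum_continuous.
Qed.

Lemma time_change_continuous u : continuous (time_change u).
Proof.
move=> t.
have u_lc m : locally_constant (fun _ : discrete_topology unit => u m) by exact: lc_cst.
have c2 := @time_change_continuous2 (discrete_topology unit) (fun=> u) u_lc (tt, t).
apply: (@cvg_comp _ _ _ (fun s => (tt : discrete_topology unit, s)) _ _ _ _ _ c2).
move=> S [[P Q] /= [/nbhs_singleton Ptt Qt] PQ]; move: Qt; apply: filterS => s Qs.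
exact: (PQ (tt, s)).
Qed.


(** At time [m] the jumps at positions up to [m - G] are complete and those from [m] on have not
    begun. The shift formula reduces this to [m = 0]. *)
Lemma time_change_bounds u (m : int) :
  (psum u (m - G%:Z))%:~R <= time_change u m%:~R <= (psum u m)%:~R.
Proof.
have at0 v : (psum v (- G%:Z))%:~R <= time_change v 0 <= 0.
  rewrite (@time_changeE _ G) ?normr0 ?add0r//.
  have -> : psum v (- G%:Z) = - \sum_(0 <= i < G) (v (- i.+1%:Z))%:Z by case: (G) G_gt0.
  have -> : tc_sum v G 0 = - \sum_(0 <= i < G) (v (- i.+1%:Z))%:R * (1 - ramp G i.+1%:R).
    rewrite -sumrN; apply: eq_bigr => i _.
    by rewrite /tc_term ramp_le0 ?mulr0 ?sub0r ?add0r// oppr_le0.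
  have ramp01 s : 0 <= s -> 0 <= ramp G s <= 1.
    by move=> s0; rewrite /ramp le_min ge_min !le_max !lexx ler01.
  rewrite intrN lerN2 oppr_le0 rmorph_sum /=; apply/andP; split.
    apply: ler_sum => i _; rewrite -[leRHS]mulr1 ler_wpM2l// lerBlDr lerDl.
    by have /andP[] := ramp01 i.+1%:R (ler0n _ _).
  apply: sumr_ge0 => i _; rewrite mulr_ge0// subr_ge0.
  by have /andP[] := ramp01 i.+1%:R (ler0n _ _).
have := at0 (fun i => u (i + m)).
rewrite time_change_shift psum_shift add0r intrB (addrC (- _)).
by move=> /andP[h1 h2]; apply/andP; split; lra.
Qed.

Section Gap.
Variable u : int -> nat.
Hypothesis u_gap : forall m, exists2 i, (i < G)%N & (0 < u (m + i%:Z))%N.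

(** Every term is nondecreasing in time, and [s] lies on the rising part of the ramp of some
    positive jump, whose term increases strictly. *)
Lemma time_change_lt : {homo time_change u : s t / s < t}.
Proof.
move=> s t st.
have [M1 sM] := exists_large s; have [M2 tM] := exists_large t.
pose M := maxn M1 M2.
have {}sM : `|s| + G%:R <= M%:R by apply: le_trans sM _; rewrite ler_nat leq_maxl.
have {}tM : `|t| + G%:R <= M%:R by apply: le_trans tM _; rewrite ler_nat leq_maxr.
rewrite !(@time_changeE _ M)//.
(* The window from [floor s - G + 1] to [floor s] consists of positions [i] with
   [i <= s < i + G]. *)
have [i' i'G] := u_gap (Num.floor s - G%:Z + 1); set i : int := _ + i'%:Z => ui.
have si : 0 <= s - i%:~R < G%:R.
  have := floor_le s; have := floorD1_gt s.
  have i'R : (i'.+1%:R <= G%:R :> R) by rewrite ler_nat.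
  have i'0 : (0 <= i'%:R :> R) by [].
  rewrite /i !intrD intrN -natr1 in i'R *; rewrite -!pmulrn; move=> h1 h2.
  by apply/andP; split; lra.
have := ler_norm s; have := ler_norm (- s); rewrite normrN => sN sP.
have term_le k : tc_term u s k <= tc_term u t k.
  rewrite /tc_term lerD ?lerN2 ?ler_wpM2l//; first by apply: ramp_homo; lra.
  by rewrite lerD2l lerN2; apply: ramp_homo; lra.
have [k kM k_lt] : exists2 k, (k < M)%N & tc_term u s k < tc_term u t k.
  case: i ui si => k ui si.
    have G0 : 0 < G%:R :> R by rewrite ltr0n.
    have /andP[si0 siG] := si; rewrite -pmulrn in si0 siG si.
    exists k; first by rewrite -(ltr_nat R); lra.
    rewrite /tc_term ltr_leD// ?lerN2 ?ler_wpM2l//.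
      by rewrite ltr_pM2l ?ltr0n// ramp_lt//; lra.
    by rewrite lerD2l lerN2; apply: ramp_homo; lra.
  have kE : (Negz k)%:~R = - k.+1%:R :> R by rewrite NegzE intrN.
  rewrite kE opprK in si; have /andP[si0 siG] := si.
  exists k; first by rewrite -(ltr_nat R); rewrite -natr1 in si0 siG; lra.
  rewrite /tc_term ler_ltD// ?ler_wpM2l//; first by apply: ramp_homo; lra.
  by rewrite ltrN2 ltr_pM2l ?ltr0n// ltrD2l ltrN2 ramp_lt//; lra.
rewrite /tc_sum !big_mkord (bigD1 (Ordinal kM))//= [ltRHS](bigD1 (Ordinal kM))//=.
by rewrite ltr_leD// ler_sum.
Qed.

Lemma time_change_inj : injective (time_change u).
Proof.
by move=> s t st; have [/time_change_lt|/time_change_lt|//] := ltgtP s t; rewrite st ltxx.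
Qed.

Lemma time_change_surj r : exists t, time_change u t = r.
Proof.
have [K rK] : exists K : nat, `|r| <= K%:R.
  by exists (Num.bound `|r|); apply/ltW/archi_boundP.
have := ler_norm r; have := ler_norm (- r); rewrite normrN => rN rP.
(* By [time_change_bounds] the value is at most [- K] at [a] and at least [K] at [b]; the extra [G]
   in [b] offsets the lag of the lower bound. *)
pose a : int := - (G * K)%:Z; pose b : int := (G * K)%:Z + G%:Z.
have ra : time_change u a%:~R <= r.
  have /andP[_ h] := time_change_bounds u a; rewrite (le_trans h)//.
  have : psum u a <= - K%:Z by apply: psum_unbounded_below.
  by rewrite -(ler_int R) intrN -pmulrn; lra.
have rb : r <= time_change u b%:~R.
  have /andP[h _] := time_change_bounds u b; rewrite (le_trans _ h)//.
  have := psum_gapM u_gap 0 K; rewrite psum0 !add0r addrK.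
  by rewrite -(ler_int R) -pmulrn; lra.
have ab : a%:~R <= b%:~R :> R by rewrite ler_int /a /b; lia.
have [||t _ <-] := @IVT R (time_change u) a%:~R b%:~R r ab; last by exists t.
  by apply: continuous_subspaceT; apply: time_change_continuous.
by rewrite ge_min le_max ra rb orbT.
Qed.

End Gap.
End TimeChange.

(** * The semiconjugacy of a cocycle pair *)

Section SemiconjugacyOfCocycle.
Variables (A B : finType) (X : shift_space A) (Y : shift_space B).
Variable h : homeo (set_type X) (set_type Y).
Variables (k l : X -> nat) (n : X -> nat) (b : X -> discrete_topology int).
Hypothesis h_ep : preserves_eventually_periodic h.
Hypothesis kl_cocycle : cocycle_pair h k l.
Hypothesis kl_lp : least_period_preserving h k l.
Hypothesis b_continuous : continuous b.
Hypothesis n_lc : locally_constant n.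
Hypothesis kl_cohom : forall x : X,
  (l x)%:Z - (k x)%:Z = (n x)%:Z + (b x : int) - (b (shift x) : int).
Local Notation shX := (@shift A X).
Local Notation shY := (@shift B Y).

(** For [e] equal to [b] plus a constant, the cohomology relation reads
    [e (shift x) - k x + l x = n x + e x]; once [e (shift x) >= k x], the cocycle identity applies
    inside the iterate. *)
Lemma exists_delay : exists e : X -> nat, locally_constant e /\
  forall x, iter (e (shift x)) shY (h (shift x)) = iter (n x) shY (iter (e x) shY (h x)).
Proof.
have [k_cont l_cont kl] := kl_cocycle.
have bounded := lc_bounded (@shift_space_compact A X).
have [K kK] := bounded _ (continuous_lc k_cont).
have [L lL] := bounded _ (continuous_lc l_cont).
have b_lc := continuous_lc b_continuous.
have [M bM] := bounded _ (lc_comp (fun c : int => `|c|%N) b_lc).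
(* Since [M] bounds [|b|], the absolute value changes nothing and every delay is at least
   [K + L]. *)
exists (fun x => `|((K + L + M)%:Z + (b x : int))%R|%N); split.
  exact: (lc_comp (fun c : int => `|((K + L + M)%:Z + c)%R|%N)).
move=> x; set e := (X in iter X shY (h (shift x)) = _).
have -> : e = (e - k x + k x)%N.
  by have := kK x; have := bM (shift x); rewrite /e; lia.
rewrite iterD kl -!iterD; congr iter.
have := kl_cohom x; have := kK x; have := lL x; have := bM x; have := bM (shift x).
by rewrite /e; lia.
Qed.

(** The coboundary of [b] telescopes to zero over a full period. *)
Lemma period_sum (x : X) : periodic_pt x ->
  (lp (h x))%:Z = \sum_(0 <= i < lp x) (n (iter i shX x))%:Z.
Proof.
move=> px; have epx : eventually_periodic x by exists 0%N.
rewrite kl_lp//.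
have tele m : \sum_(0 <= i < m) ((l (iter i shX x))%:Z - (k (iter i shX x))%:Z) =
    \sum_(0 <= i < m) (n (iter i shX x))%:Z + (b x : int) - (b (iter m shX x) : int).
  elim: m => [|m IHm]; first by rewrite !big_geq// add0r subrr.
  rewrite !big_nat_recr//= IHm kl_cohom/=; ring.
by rewrite tele lp_periodic// addrK.
Qed.

Lemma speed_not0 (x : X) : exists i, (0 < n (iter i shX x))%N.
Proof.
apply: contrapT => /forallNP n0.
have {}n0 i : n (iter i shX x) = 0%N by have := n0 i; case: (n _) => // ? [].
have [e [e_lc eE]] := exists_delay.
have [E eb] := lc_bounded (@shift_space_compact A X) e_lc.
pose z := iter (e x) shY (h x).
(* With zero speed along the orbit, all delayed images coincide. *)
have zE i : iter (e (iter i shX x)) shY (h (iter i shX x)) = z.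
  by elim: i => //= i IHi; rewrite eE n0.
(* Past its delay, [h (iter i shX x)] reads [z], so it is determined by the delay and its first [E]
   symbols; this leaves finitely many values and the pigeonhole principle applies. *)
pose T : finType := ('I_E.+1 * {ffun 'I_E -> B})%type.
pose F (i : 'I_#|T|.+1) : T := (inord (e (iter i shX x)),
  [ffun j : 'I_E => set_val (h (iter i shX x)) j]).
have [i [j [ij Fij]]] : exists i j : 'I_#|T|.+1, (i < j)%N /\ F i = F j.
  have : ~ injective F by move=> /leq_card; rewrite card_ord ltnn.
  move=> /existsNP [i /existsNP [j /not_implyP [Fij /eqP ij]]].
  by move: ij; rewrite neq_ltn => /orP [ij|ij]; [exists i, j|exists j, i].
have xij : iter i shX x = iter j shX x.
  apply: (can_inj (@homeoK _ _ h)).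
  have [eij wij] : e (iter i shX x) = e (iter j shX x) /\
      forall p : 'I_E, set_val (h (iter i shX x)) p = set_val (h (iter j shX x)) p.
    move: Fij => /= [] /(congr1 val); rewrite /= !inordK ?ltnS// => -> /ffunP wij.
    split=> // p.
    by have := wij p; rewrite !ffunE.
  apply: one_sided_eq => p; have [pE|Ep] := ltnP p E; first exact: (wij (Ordinal pE)).
  have ep : (e (iter i shX x) <= p)%N by rewrite (leq_trans (eb _)).
  rewrite -(subnKC ep) -iter_shiftE zE -(zE j) eij iter_shiftE//.
have px : periodic_pt (iter i shX x).
  by exists (j - i)%N; rewrite ?subn_gt0// -iterD subnK ?(ltnW ij)//.
(* A vanishing sum over the period contradicts the positivity of the least period of the image. *)
have := period_sum px; rewrite big1 => [/eqP|p _]; last by rewrite -iterD n0.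
have /lpP [] : eventually_periodic (h (iter i shX x)) by apply/h_ep; exists 0%N.
by case: lp.
Qed.

Lemma exists_gap : exists G : nat, forall x,
  exists2 i, (i < G)%N & (0 < n (iter i shX x))%N.
Proof.
pose P G x := exists2 i, (i < G)%N & (0 < n (iter i shX x))%N.
apply: (@compact_eventually _ P); first exact: shift_space_compact.
  by move=> G G' GG' x [i iG ni]; exists i => //; apply: leq_trans GG'.
move=> x; have [i ni] := speed_not0 x; exists i.+1.
have := lc_continuous (@iter_shift_continuous A X i) n_lc x.
by apply: filterS => y yx; exists i; rewrite // yx.
Qed.

End SemiconjugacyOfCocycle.

Section Delay.
Variables (A B : finType) (X : shift_space A) (Y : shift_space B).
Variables (h : X -> Y) (n e : X -> nat).
Hypothesis h_continuous : continuous h.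
Hypothesis e_lc : locally_constant e.

Definition delayed (x : X) : Y := iter (e x) (@shift B Y) (h x).

Lemma delayed_continuous : continuous delayed.
Proof.
apply: continuous_coord => j.
have -> : (fun x => set_val (delayed x) j) = (fun x => set_val (h x) (e x + j)%N).
  by apply/funext => x; rewrite iter_shiftE.
apply: (lc_bind (f := fun p x => set_val (h x) (p + j)%N)) => // p.
by apply: (lc_continuous (f := fun y : Y => set_val y (p + j)%N)) => //; apply: coord_lc.
Qed.

End Delay.

(** * The two extensions are mutually inverse on shift orbits *)

Section RoundTrip.
Variables (A B : finType) (X : shift_space A) (Y : shift_space B).
Variables (h : X -> Y) (h' : Y -> X) (n e : X -> nat) (n' e' : Y -> nat) (G G' : nat).
Local Notation shX := (@shift A X).
Local Notation shY := (@shift B Y).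
Local Notation g := (delayed h e).
Local Notation g' := (delayed h' e').
Hypothesis hK : cancel h h'.
Hypothesis n'_lc : locally_constant n'.
Hypothesis e_lc : locally_constant e.
Hypothesis e'_lc : locally_constant e'.
Hypothesis g_shift : forall x, g (shift x) = iter (n x) shY (g x).
Hypothesis g'_shift : forall y, g' (shift y) = iter (n' y) shX (g' y).
Hypothesis n_gap : forall x, exists2 i, (i < G)%N & (0 < n (iter i shX x))%N.
Hypothesis n'_gap : forall y, exists2 i, (i < G')%N & (0 < n' (iter i shY y))%N.

(** Going through [g] and back through [g'] advances a ray by at most [U] steps, uniformly; hence
    both sequences share rays starting arbitrarily far to the left and [shared_rays_shift]
    applies. *)
Lemma ext_ext_orbit x : exists s, ext g'_shift n'_gap (ext g_shift n_gap x) = tsh s x.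
Proof.
have [E eE] := lc_bounded (@shift_space_compact A X) e_lc.
have [E' eE'] := lc_bounded (@shift_space_compact B Y) e'_lc.
have [M nM] := lc_bounded (@shift_space_compact B Y) n'_lc.
have g'_iter p y : exists2 q, (q <= p * M)%N & g' (iter p shY y) = iter q shX (g' y).
  elim: p => [|p [q qp IH]]; first by exists 0%N.
  exists (n' (iter p shY y) + q)%N; first by rewrite mulSn leq_add.
  by rewrite iterS g'_shift IH iterD.
pose U := (E * M + E')%N.
have back z : exists2 q, (q <= U)%N & g' (g z) = iter q shX z.
  have [q qe qE] := g'_iter (e z) (h z).
  exists (q + e' (h z))%N; last by rewrite [LHS]qE iterD /delayed hK.
  by rewrite leq_add// (leq_trans qe)// leq_mul.
set y := ext g_shift n_gap x; set x' := ext _ _ y.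
suff [s sE] : exists s : int, forall j, set_val x' j = set_val x (j + s).
  by exists s; apply: two_sided_eq => j; rewrite sE.
apply: shared_rays_shift => K.
have G0 : (0 < G)%N by have [i iG _] := n_gap (ray x 0); apply: leq_ltn_trans iG.
(* The term [G' * |K|] puts the position on the round-trip side below [- |K|], while [U + |K|] keeps
   [m + q] at most [K] for every [q <= U]. *)
pose r := (G' * `|K| + U + `|K|)%N; pose m : int := - (G * r)%:Z.
have Nm : psum (speed n x) m <= - r%:Z by apply: psum_unbounded_below (speed_gap n_gap x) r.
have [q qU qE] := back (ray x m).
exists (psum (speed n' y) (psum (speed n x) m)), (m + q%:Z); split.
- have h1 := psum_unbounded_below (speed_gap n'_gap y) `|K|%N.
  have h2 : psum (speed n' y) (psum (speed n x) m) <=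
      psum (speed n' y) (- (G' * `|K|)%:Z).
    by apply: psum_le; rewrite (le_trans Nm)//; rewrite /r; lia.
  by rewrite (le_trans h2)// (le_trans h1)//; lia.
- have rGr : (r <= G * r)%N by rewrite leq_pmull.
  by rewrite /m; rewrite /r in rGr *; lia.
by move=> i; rewrite -!rayE -iter_shift_ray -qE /x' ray_ext /y ray_ext.
Qed.

End RoundTrip.

(** * The flow equivalence *)

Section SuspensionMap.
Variables (R : realType) (A B : finType) (X : shift_space A) (Y : shift_space B).
Variables (n : X -> nat) (g : X -> Y) (G : nat).
Local Notation shX := (@shift A X).
Local Notation shY := (@shift B Y).
Hypothesis n_lc : locally_constant n.
Hypothesis g_continuous : continuous g.
Hypothesis g_shift : forall x, g (shift x) = iter (n x) shY (g x).
Hypothesis n_gap : forall x, exists2 i, (i < G)%N & (0 < n (iter i shX x))%N.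
Hypothesis G_gt0 : (0 < G)%N.

Local Notation extg := (ext g_shift n_gap).
Local Notation N x := (psum (speed n x)).
Local Notation f x := (@time_change R G (speed n x)).

Lemma time_change_tsh d x t : f (tsh d x) t = f x (t + d%:~R) - (N x d)%:~R.
Proof. by rewrite speed_tsh time_change_shift. Qed.

Definition base_map (p : two_sided X * R) : suspension Y R :=
  suspension_class (extg p.1) (f p.1 p.2).

Lemma base_map_class x y t r : suspension_class x t = suspension_class y r ->
  base_map (x, t) = base_map (y, r).
Proof.
move=> /suspension_classP [d [-> ->]]; rewrite /base_map /=.
by rewrite ext_tsh suspension_class_tsh time_change_tsh subrK.
Qed.

Lemma base_map_continuous : continuous base_map.
Proof.
move=> [x t].
have c1 : {for (x, t), continuous (fun p : two_sided X * R => extg p.1)}.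
  apply: (@cvg_comp _ _ _ fst extg _ (nbhs x)); first exact: cvg_fst.
  exact: ext_continuous.
have c2 : {for (x, t), continuous (fun p : two_sided X * R => f p.1 p.2)}.
  have lc m : locally_constant (fun y : two_sided X => speed n y m) by exact: speed_lc.
  exact: (time_change_continuous2 (v := speed n) G_gt0 lc).
have cF : {for (x, t), continuous (fun p : two_sided X * R => (extg p.1, f p.1 p.2))}.
  exact: (cvg_pair c1 c2).
have pc := @pi_continuous _ (suspension Y R) (extg x, f x t).
exact: (continuous_comp cF pc).
Qed.

Definition suspension_map (p : suspension X R) : suspension Y R := base_map (repr p).

Lemma suspension_map_class x t :
  suspension_map (suspension_class x t) = suspension_class (extg x) (f x t).
Proof.
rewrite /suspension_map; case E : (repr _) => [y r].
by apply: base_map_class; rewrite /suspension_class -E reprK.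
Qed.

Lemma suspension_map_continuous : continuous suspension_map.
Proof.
apply: repr_comp_continuous; first exact: base_map_continuous.
by move=> [x t] [y r] /eqP xy; apply/eqP; apply: base_map_class.
Qed.

Variables (n' : Y -> nat) (g' : Y -> X) (G' : nat).
Hypothesis g'_shift : forall y, g' (shift y) = iter (n' y) shX (g' y).
Hypothesis n'_gap : forall y, exists2 i, (i < G')%N & (0 < n' (iter i shY y))%N.
Local Notation extg' := (ext g'_shift n'_gap).
Hypothesis ext_ext : forall x, exists s, extg' (extg x) = tsh s x.
Hypothesis ext'_ext' : forall y, exists s, extg (extg' y) = tsh s y.

Lemma suspension_map_surj q : exists p, suspension_map p = q.
Proof.
have [y [r ->]] := suspension_classK q; have [s sE] := ext'_ext' y.
have [t tE] := time_change_surj G_gt0 (speed_gap n_gap (extg' y)) (r - s%:~R).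
exists (suspension_class (extg' y) t).
by rewrite suspension_map_class tE sE suspension_class_tsh subrK.
Qed.

(** Applying [extg'] brings both points back to their own orbits and turns the shift by [d] into
    another shift. *)
Lemma ext_orbit_inj x1 x2 d : extg x1 = tsh d (extg x2) -> exists c, x1 = tsh c x2.
Proof.
move=> /(congr1 extg'); rewrite ext_tsh.
have [s1 ->] := ext_ext x1; have [s2 ->] := ext_ext x2.
move=> /(congr1 (tsh (- s1))); rewrite !tsh_tsh addNr tsh0 => ->.
by eexists.
Qed.

Hypothesis n_period : forall x : X, periodic_pt x ->
  (lp (g x))%:Z = \sum_(0 <= i < lp x) (n (iter i shX x))%:Z.

Lemma suspension_map_inj : injective suspension_map.
Proof.
move=> p1 p2; have [x1 [t1 ->]] := suspension_classK p1.
have [x [s2 ->]] := suspension_classK p2.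
(* By [ext_orbit_inj], two classes with the same image have representatives over the same [x]. *)
suff same_orbit s1 : suspension_map (suspension_class x s1) =
    suspension_map (suspension_class x s2) -> suspension_class x s1 = suspension_class x s2.
  move=> psi12; have := psi12; rewrite !suspension_map_class.
  move=> /suspension_classP [d [/ext_orbit_inj [c x1E] _]]; move: psi12.
  by rewrite x1E suspension_class_tsh; apply: same_orbit.
rewrite !suspension_map_class => /suspension_classP [d [yd fd]].
have f_inj := time_change_inj G_gt0 (speed_gap n_gap x) (R := R).
have [d0|d0] := eqVneq d 0.
  by move: fd; rewrite d0 addr0 => /f_inj ->.
(* A nonzero [d] forces the image point to be periodic. *)
have yp : tsh `|d|%N%:Z (extg x) = extg x.
  case: (ltgtP d 0) d0 => // [d_lt|d_gt] _.
    have -> : `|d|%N%:Z = - d by lia.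
    by rewrite {1}yd tsh_tsh addNr tsh0.
  by have -> : `|d|%N%:Z = d by lia.
(* A period of [extg x] is carried back by [extg']; taking [G' * |d|] steps makes the partial sum
   [P] at least [|d|], hence positive. *)
have [P P0 xP] : exists2 P : nat, (0 < P)%N & tsh P%:Z x = x.
  pose P := psum (speed n' (extg x)) (G'%:Z * `|d|%N%:Z).
  have P1 : 1 <= P.
    have := psum_gapM (speed_gap n'_gap (extg x)) 0 `|d|%N.
    by rewrite psum0 !add0r PoszM -/P; lia.
  exists `|P|%N; first lia.
  have -> : `|P|%N%:Z = P by lia.
  have := ext_tsh g'_shift n'_gap (G'%:Z * `|d|%N%:Z) (extg x).
  rewrite tsh_mul// -/P; have [s ->] := ext_ext x.
  by move=> /(congr1 (tsh (- s))); rewrite !tsh_tsh addNr tsh0 addrAC addNr add0r => <-.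
have px0 : periodic_pt (ray x 0).
  by exists P => //; rewrite iter_shift_ray -ray_tsh xP.
set q := lp (ray x 0); set Q := lp (g (ray x 0)).
(* The period [q] of the ray is valid on nonnegative positions, and the period [P] of [x] spreads it
   to the left. *)
have xq : tsh q%:Z x = x.
  apply: two_sided_eq => j; rewrite tshE.
  apply: (eventually_periodic_eq (P := P%:Z) (N := 0)); first by [].
    by move=> i; rewrite -tshE xP.
  move=> i i0; have -> : i = 0 + `|i|%N%:Z by lia.
  rewrite -[RHS]rayE -(lp_periodic px0) iter_shift_ray rayE; congr (set_val _ _).
  by rewrite -/q; lia.
(* One turn around the orbit of [x] is exactly one turn around the image orbit, so the map cannot
   wrap a closed flow line several times. *)
have Nq : psum (speed n x) q = Q.
  have := psumD (speed n x) 0 q; rewrite psum0 !add0r => ->.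
  rewrite /Q n_period//; by apply: eq_bigr => i _; rewrite iter_shift_ray.
have Qd : (Q %| `|d|)%N.
  apply: lp_dvd; split; first lia.
  exists `|d|%N, 0%N; split; first lia.
  have := ray_ext g_shift n_gap x 0; rewrite psum0 => <-.
  by rewrite iter_shift_ray add0r -{2}yp ray_tsh add0r.
have [c dE] : exists c : int, d = c * Q%:Z.
  by exists (d %/ Q%:Z)%Z; rewrite divzK// /dvdz.
have fq (e : int) t : f x (t + (e * q%:Z)%:~R) = f x t + (e * Q%:Z)%:~R.
  have step s : f x (s + q%:R) = f x s + Q%:R.
    have := time_change_tsh q x s; rewrite xq Nq => ->; rewrite -!pmulrn; ring.
  elim/int_shift_ind: e t => [t|e]; first by rewrite !mul0r !addr0.
  split=> IH t; rewrite ?mulrDl ?mul1r ?intrD -?pmulrn.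
    by rewrite addrA step IH addrA.
  have := IH t; rewrite !mulrDl !mul1r !intrD -!pmulrn !addrA step.
  by move=> /addIr.
(* A lag of [c] image periods comes from [c] periods of [x], which do not change the class. *)
have s2E : s2 = s1 + (c * q%:Z)%:~R by apply: f_inj; rewrite fq -dE.
by rewrite s2E -suspension_class_tsh tsh_mul.
Qed.

Lemma suspension_flow_equivalence : flow_equivalent R X Y.
Proof.
have [psi psiE] := compact_hausdorff_homeo (@suspension_compact _ X R)
  (@suspension_hausdorff _ Y R) suspension_map_continuous suspension_map_inj
  suspension_map_surj.
exists psi => x t y r s u; rewrite psiE !suspension_map_class.
move=> /suspension_classP [d [yE rE]] s0 u0.
have f_lt := time_change_lt G_gt0 (speed_gap n_gap x) (R := R).
have reclass v : suspension_class (extg x) (f x t + v) = suspension_class y (r + v).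
  by rewrite yE suspension_class_tsh rE addrAC.
split.
  exists (f x (t + s) - f x t); first by rewrite subr_gt0 f_lt// ltrDl.
  by rewrite -reclass subrKC.
(* For the inverse, [t'] is the time at which [f x] has advanced by [u]. *)
have [t' t'E] := time_change_surj G_gt0 (speed_gap n_gap x) (f x t + u).
have tt' : t < t'.
  rewrite ltNge; apply/negP; rewrite le_eqVlt => /orP [/eqP e|/f_lt].
    by move: t'E; rewrite e; lra.
  by rewrite t'E; lra.
exists (t' - t); first by rewrite subr_gt0.
rewrite subrKC; apply: (can_inj (@homeoK _ _ psi)).
rewrite /= homeo_invK psiE suspension_map_class t'E reclass//.
Qed.

End SuspensionMap.

Theorem proposition3p2 (R : realType) (A B : finType)
  (X : shift_space A) (Y : shift_space B)
  (h : homeo (set_type X) (set_type Y))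
  (h_coe : continuous_orbit_equivalence h)
  (h_ep : preserves_eventually_periodic h)
  (k l : X -> nat)
  (kl_cocycle : cocycle_pair h k l)
  (kl_lp : least_period_preserving h k l)
  (k' l' : Y -> nat)
  (kl'_cocycle : cocycle_pair (homeo_inv h) k' l')
  (kl'_lp : least_period_preserving (homeo_inv h) k' l')
  (b : X -> discrete_topology int) (n : X -> nat)
  (b' : Y -> discrete_topology int) (n' : Y -> nat)
  (b_continuous : continuous b) (n_continuous : continuous n)
  (b'_continuous : continuous b') (n'_continuous : continuous n')
  (kl_cohom : forall x : X,
     (l x)%:Z - (k x)%:Z = (n x)%:Z + (b x : int) - (b (shift x) : int))
  (kl'_cohom : forall y : Y,
     (l' y)%:Z - (k' y)%:Z = (n' y)%:Z + (b' y : int) - (b' (shift y) : int)) :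
  flow_equivalent R X Y.
Proof.
have n_lc := continuous_lc n_continuous; have n'_lc := continuous_lc n'_continuous.
have h'_ep : preserves_eventually_periodic (homeo_inv h).
  by move=> y; rewrite -h_ep homeo_invK.
have [e [e_lc eE]] := exists_delay kl_cocycle b_continuous kl_cohom.
have [e' [e'_lc e'E]] := exists_delay kl'_cocycle b'_continuous kl'_cohom.
have [G0 gap0] := exists_gap h_ep kl_cocycle kl_lp b_continuous n_lc kl_cohom.
have [G' gap'] := exists_gap h'_ep kl'_cocycle kl'_lp b'_continuous n'_lc kl'_cohom.
(* The successor makes the ramp length positive. *)
have gap x : exists2 i, (i < G0.+1)%N & (0 < n (iter i (@shift A X) x))%N.
  by have [i iG ni] := gap0 x; exists i => //; apply: ltnW.
have c := @homeo_continuous _ _ h; have c' := @homeo_inv_continuous _ _ h.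
apply: (@suspension_flow_equivalence R A B X Y n (delayed h e) G0.+1 n_lc _ eE gap isT
  n' (delayed (homeo_inv h) e') G' e'E gap').
- exact: delayed_continuous.
- exact: (ext_ext_orbit (@homeoK _ _ h)).
- exact: (ext_ext_orbit (@homeo_invK _ _ h)).
(* Shifting [h x] by the delay leaves its least period unchanged, so [period_sum] carries over to
   the delayed map. *)
move=> x px; rewrite -(period_sum kl_lp kl_cohom px) /delayed lp_iter//.
by apply/h_ep; exists 0%N.
Qed.
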